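(* Let $(S,\circ,BB)$ be an Assembly Space and let $\mathscr{O}\in S$ be Binary Decomposable, with $s(\mathscr{O})=2^{n_1}+2^{n_2}+\cdots+2^{n_H}$, $n_1>n_2>\cdots>n_H\ge 0$, $H=H(s(\mathscr{O}))$. Then \[ a(\mathscr{O})\;\le\;\big(H-1\big)+\sum_{i=1}^{n_1}\min\Big\{\sum_{j=1}^{H}\big\lfloor 2^{\,n_j-i}\big\rfloor,\ \mathrm{Card}\big(S(2^i)\big)\Big\}. \]
   Context: A Multi-Magma $(S,\circ)$ is a set $S$ together with a binary operation $\circ:2^S\times 2^S\to 2^S$, extended element-wise: for $A,A'\subseteq S$, $A\circ A'=\bigcup_{x\in A,\,y\in A'}\{x\}\circ\{y\}$. A subset $BB\subseteq S$ is fixed as the set of Building Blocks. Assembly Addition Chains: for $\mathscr{O}\in S\setminus BB$, an AAC of $\mathscr{O}$ is a finite sequence $(\mathscr{O}_1,\dots,\mathscr{O}_r)$ of elements of $S$ with $\mathscr{O}_r=\mathscr{O}$, $\mathscr{O}_1\in\{\mathscr{B}\}\circ\{\mathscr{B}'\}$ for some $\mathscr{B},\mathscr{B}'\in BB$, and for each $\rho\in\{2,\dots,r\}$ there exist $\mathscr{O}_\sigma,\mathscr{O}_\tau\in\{\mathscr{O}_1,\dots,\mathscr{O}_{\rho-1}\}\cup BB$ with $\mathscr{O}_\rho\in\{\mathscr{O}_\sigma\}\circ\{\mathscr{O}_\tau\}$. Its length is $r$. Assembly Multi-Magma: for every $\mathscr{O}\in S\setminus BB$: (1) there exist $\mathscr{B}_0,\dots,\mathscr{B}_r\in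 BB$ and an AAC $\Gamma(\mathscr{O})=(\mathscr{O}_1,\dots,\mathscr{O}_r=\mathscr{O})$ with $\mathscr{O}_1\in\{\mathscr{B}_0\}\circ\{\mathscr{B}_1\}$, $\mathscr{O}_i\in\{\mathscr{O}_{i-1}\}\circ\{\mathscr{B}_i\}$ ($i\ge 2$); (2) any other such chain from blocks $\overline{\mathscr{B}}_0,\dots,\overline{\mathscr{B}}_s$ has $s=r$ and the blocks are a permutation of the $\mathscr{B}_i$. Size: $s(\mathscr{O})=1$ for $\mathscr{O}\in BB$, $s(\mathscr{O})=r+1$ otherwise. Assembly Space: additionally $s(\mathscr{O})=s(\mathscr{O}_\sigma)+s(\mathscr{O}_\tau)$ whenever $\mathscr{O}\in S\setminus BB$ and $\mathscr{O}\in\{\mathscr{O}_\sigma\}\circ\{\mathscr{O}_\tau\}$. Assembly Index: $a(\mathscr{O})=0$ for $\mathscr{O}\in BB$, otherwise the minimal length of an AAC of $\mathscr{O}$. $S(k)=\{\mathscr{O}\in S: s(\mathscr{O})=k\}$, $\mathrm{Card}$ denotes cardinality, and $H(k)$ is the Hamming weight (number of 1's in the binary expansion) of $k$. Balanced products: for $\mathscr{B}_1,\dots,\mathscr{B}_{2^m}\in BB$ define $T(\mathscr{B}_1)=\{\mathscr{B}_1\}$ and, for $m\ge1$, $T(\mathscr{B}_1,\dots,\mathscr{B}_{2^m})=T(\mathscr{B}_1,\dots,\mathscr{B}_{2^{m-1}})\circ T(\mathscr{B}_{2^{m-1}+1},\dots,\mathscr{B}_{2^m})$. Binary Decomposable objects: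 with $s(\mathscr{O})=2^{n_1}+\cdots+2^{n_H}$, $n_1>\cdots>n_H\ge0$, $\mathscr{O}$ is Binary Decomposable if there exist building blocks $\mathscr{B}^{(i)}_j\in BB$ ($i=1,\dots,H$, $j=1,\dots,2^{n_i}$) and objects $\mathscr{P}_i\in T(\mathscr{B}^{(i)}_1,\dots,\mathscr{B}^{(i)}_{2^{n_i}})$ such that $\mathscr{O}\in\{\mathscr{P}_H\}\circ\big(\cdots\circ(\{\mathscr{P}_3\}\circ(\{\mathscr{P}_2\}\circ\{\mathscr{P}_1\}))\cdots\big)$ (for $H=1$ this means $\mathscr{O}=\mathscr{P}_1$). *)

(* Defs.v *)
From mathcomp Require Import all_boot all_order all_algebra all_fingroup finmap.
From mathcomp Require Import boolp classical_sets functions cardinality.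

Set Implicit Arguments.
Unset Strict Implicit.
Unset Printing Implicit Defensive.

Local Open Scope classical_set_scope.
Local Open Scope nat_scope.

(* The library is MathComp with its classical-sets layer.  A finite sequence
   x_1, ..., x_r of elements of S is encoded as a function nat -> S of which
   only the values at 1, ..., r matter. *)

Record multiMagma := MultiMagma {
  carrier :> Type;
  mop : set carrier -> set carrier -> set carrier;
  mopE : forall A A' : set carrier,
    mop A A' = \bigcup_(x in A) \bigcup_(y in A') mop [set x] [set y]
}.

(* c 1, ..., c r is an assembly addition chain of O; O is meant to lie
   outside BB. *)
Definition AAC (S : multiMagma) (BB : set S) (O : S) (r : nat)
    (c : nat -> S) : Prop :=
  [/\ 0 < r,
      c r = O,
      exists B B' : S, [/\ BB B, BB B' & mop [set B] [set B'] (c 1)]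
    & forall rho, 2 <= rho <= r ->
        exists x y : S,
          [/\ (c @` [set i | 1 <= i < rho] `|` BB) x,
              (c @` [set i | 1 <= i < rho] `|` BB) y
            & mop [set x] [set y] (c rho)]].

(* A chain that adds one of the blocks B 0, ..., B r at a time. *)
Definition block_chain (S : multiMagma) (BB : set S) (O : S) (r : nat)
    (B c : nat -> S) : Prop :=
  [/\ AAC BB O r c,
      forall i, i <= r -> BB (B i),
      mop [set B 0] [set B 1] (c 1)
    & forall i, 2 <= i <= r -> mop [set c i.-1] [set B i] (c i)].

Definition assembly_multi_magma (S : multiMagma) (BB : set S) : Prop :=
  forall O : S, ~ BB O ->
    exists (r : nat) (B c : nat -> S),
      block_chain BB O r B c /\
      forall (s : nat) (B' c' : nat -> S), block_chain BB O s B' c' ->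
        s = r /\ exists p : {perm 'I_r.+1}, forall i : 'I_r.+1, B' i = B (p i).

(* In an assembly multi-magma the set below is a singleton when O is not in
   BB, so the default value of xget is irrelevant. *)
Definition asize (S : multiMagma) (BB : set S) (O : S) : nat :=
  if `[< BB O >] then 1
  else xget 0 [set k | exists (r : nat) (B c : nat -> S),
                         block_chain BB O r B c /\ k = r.+1].

Definition assembly_space (S : multiMagma) (BB : set S) : Prop :=
  assembly_multi_magma BB /\
  forall O x y : S, ~ BB O -> mop [set x] [set y] O ->
    asize BB O = asize BB x + asize BB y.

(* As for asize, the default value is never used in an assembly multi-magma. *)
Definition assembly_index (S : multiMagma) (BB : set S) (O : S) : nat :=
  if `[< BB O >] then 0
  else xget 0 [set r | (exists c : nat -> S, AAC BB O r c) /\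
                       forall (r' : nat) (c' : nat -> S),
                         AAC BB O r' c' -> r <= r'].

Definition size_class (S : multiMagma) (BB : set S) (k : nat) : set S :=
  [set O | asize BB O = k].

(* min {k, Card A}, where Card A may be infinite; {classic T} is T with the
   choiceType structure that fset_set requires. *)
Definition min_card (T : Type) (k : nat) (A : set T) : nat :=
  if `[< finite_set A >] then minn k #|` fset_set (A : set {classic T}) |
  else k.

(* Bits of index >= k are 0 because k < 2 ^ k. *)
Definition hamming_weight (k : nat) : nat :=
  \sum_(i < k) odd (k %/ 2 ^ i).

(* k = 2 ^ n_1 + ... + 2 ^ n_H with n_1 > ... > n_H. *)
Definition binary_expansion (k H : nat) (n : nat -> nat) : Prop :=
  (forall i j, 1 <= i -> i < j -> j <= H -> n j < n i) /\
  k = \sum_(1 <= j < H.+1) 2 ^ n j.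

(* T (B 1, ..., B (2 ^ m)) *)
Fixpoint balanced (S : multiMagma) (m : nat) (B : nat -> S) : set S :=
  if m is m'.+1
  then mop (balanced m' B) (balanced m' (fun j => B (2 ^ m' + j)))
  else [set B 1].

(* {P_(h+1)} o ( ... o ({P_3} o ({P_2} o {P_1})) ... ) *)
Fixpoint nested (S : multiMagma) (P : nat -> S) (h : nat) : set S :=
  if h is h'.+1 then mop [set P h'.+2] (nested P h') else [set P 1].

Definition binary_decomposable (S : multiMagma) (BB : set S) (O : S) : Prop :=
  exists (H : nat) (n : nat -> nat),
    binary_expansion (asize BB O) H n /\
    exists (B : nat -> nat -> S) (P : nat -> S),
      [/\ forall i j, 1 <= i <= H -> 1 <= j <= 2 ^ n i -> BB (B i j),
          forall i, 1 <= i <= H -> balanced (n i) (B i) (P i)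
        & nested P H.-1 O].

(* Main.v *)
(* Sizes are at most additive: a balanced product of [2 ^ m] blocks has size at
   most [2 ^ m], with equality only if each intermediate product of [2 ^ i]
   blocks has size exactly [2 ^ i].  The hypothesis on the size of [O] forces
   equality everywhere, so the intermediate products at level [i] all lie in
   [S (2 ^ i)], and there are at most [sum_j floor (2 ^ (n_j - i))] of them.
   Assembling each of them once, level by level, and then performing the
   [H - 1] outer products gives a chain of the required length. *)
Require Import Defs.
From mathcomp Require Import all_boot all_order all_algebra all_fingroup finmap.
From mathcomp Require Import boolp classical_sets functions cardinality.
From mathcomp Require Import zify.

Set Implicit Arguments.
Unset Strict Implicit.
Unset Printing Implicit Defensive.

Local Open Scope classical_set_scope.
Local Open Scope nat_scope.

(** * Uniqueness of binary expansions *)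

Lemma sum_expn2_lt (s : seq nat) (x : nat) :
  path gtn x s -> \sum_(i <- s) 2 ^ i < 2 ^ x.
Proof.
elim: s x => [|y s IHs] x /=; first by rewrite big_nil expn_gt0.
move=> /andP[ltyx /IHs lts]; rewrite big_cons.
apply: (@leq_trans (2 ^ y.+1)); last by rewrite leq_exp2l.
by rewrite expnS mul2n -addnn ltn_add2l.
Qed.

(** The powers after the head [x] sum to less than [2 ^ x], so the total determines the largest
    exponent; cancel it and recurse. *)
Lemma sum_expn2_inj (s t : seq nat) : sorted gtn s -> sorted gtn t ->
  \sum_(i <- s) 2 ^ i = \sum_(i <- t) 2 ^ i -> s = t.
Proof.
elim: s t => [|x s IHs] [|y t] //= ps pt; rewrite ?big_cons ?big_nil.
- by move/eqP; rewrite eq_sym addn_eq0 expn_eq0.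
- by move/eqP; rewrite addn_eq0 expn_eq0.
move=> eq_sum.
have head_le a b u v : path gtn b v ->
    2 ^ a + \sum_(i <- u) 2 ^ i = 2 ^ b + \sum_(i <- v) 2 ^ i -> a <= b.
  move=> pv eq_ab; rewrite leqNgt; apply/negP => lt_ba.
  have /sum_expn2_lt : path gtn a (b :: v) by rewrite /= lt_ba.
  by rewrite big_cons -eq_ab ltnNge leq_addr.
have eqxy : x = y.
  by apply/eqP; rewrite eqn_leq (head_le _ _ s t) // (head_le _ _ t s).
move: eq_sum; rewrite eqxy => /addnI eq_sum.
by rewrite (IHs t) // (path_sorted ps, path_sorted pt).
Qed.

Lemma binary_expansion_sorted (k H : nat) (n : nat -> nat) :
  binary_expansion k H n -> sorted gtn [seq n j | j <- index_iota 1 H.+1].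
Proof.
case=> decr _; rewrite sorted_map.
apply: (@sub_in_sorted _ (fun j => 1 <= j <= H) ltn); last first.
- exact: iota_ltn_sorted.
- by apply/allP => j; rewrite mem_index_iota ltnS.
by move=> i j /andP[i1 _] /andP[_ jH] ltij; apply: decr.
Qed.

(** Identifies the exponents hidden in [binary_decomposable] with those given in the theorem. *)
Lemma binary_expansion_inj (k H H' : nat) (n n' : nat -> nat) :
  binary_expansion k H n -> binary_expansion k H' n' ->
  H = H' /\ forall j, 1 <= j <= H -> n j = n' j.
Proof.
move=> hn hn'.
have eqs : [seq n j | j <- index_iota 1 H.+1] =
           [seq n' j | j <- index_iota 1 H'.+1].
  apply: sum_expn2_inj.
  - exact: binary_expansion_sorted hn.
  - exact: binary_expansion_sorted hn'.
  by rewrite !big_map -hn.2 -hn'.2.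
have eqH : H = H'.
  by have := congr1 size eqs; rewrite !size_map !size_iota !subn1.
split=> // j hj; rewrite -eqH in eqs.
by have /eq_in_map -> // := eqs; rewrite mem_index_iota ltnS.
Qed.

Lemma min_card_uniq (T : Type) (k : nat) (A : set T) (l : seq {classic T}) :
  uniq l -> (forall x, x \in l -> A x) -> size l <= k ->
  size l <= min_card k A.
Proof.
move=> ul lA lk; rewrite /min_card; case: asboolP => // finA.
rewrite leq_min lk; apply: uniq_leq_size => // x /lA Ax.
by rewrite in_fset_set // mem_set.
Qed.

(** * Assembly addition chains as reversed lists *)

Section Assembly.
Variables (S : multiMagma) (BB : set S).
Implicit Types (x y z O w : {classic S}) (l : seq {classic S}).

Lemma mopP (A A' : set S) z :
  mop A A' z -> exists x y, [/\ A x, A' y & mop [set x] [set y] z].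
Proof. by rewrite mopE => -[x Ax [y Ay xyz]]; exists x, y. Qed.

Definition available l x := x \in l \/ BB x.

Definition producible l x := exists y z,
  [/\ available l y, available l z & mop [set y] [set z] x].

(* An assembly addition chain listed in reverse, the last object first. *)
Fixpoint rev_chain l : Prop :=
  if l is x :: l' then producible l' x /\ rev_chain l' else True.

Lemma available_sub l l' x :
  {subset l <= l'} -> available l x -> available l' x.
Proof. by move=> sub [/sub|]; [left|right]. Qed.

(** Members of [l'] need only operands available from [l], so a whole level can be added at once, in
    any order. *)
Lemma rev_chain_cat l l' : (forall x, x \in l' -> producible l x) ->
  rev_chain l -> rev_chain (l' ++ l).
Proof.
move=> + chl; elim: l' => //= x l' IHl' prod; split; last first.
  by apply: IHl' => y yl'; apply: prod; rewrite inE yl' orbT.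
have sub : {subset l <= l' ++ l} by move=> y yl; rewrite mem_cat yl orbT.
have [|y [z [ay az xyz]]] := prod x; first by rewrite inE eqxx.
by exists y, z; split=> //; apply: available_sub sub _.
Qed.

Lemma rev_chain_drop k l : rev_chain l -> rev_chain (drop k l).
Proof. by elim: l k => [|x l IHl] [|k] //= [_]; apply: IHl. Qed.

(** Drop what was produced after [x], then read the remaining list backwards: it is a chain ending
    in [x]. *)
Lemma rev_chain_AAC l x : rev_chain l -> x \in l ->
  exists r c, AAC BB x r c /\ r <= size l.
Proof.
move=> chl xl.
pose u : seq {classic S} := drop (index (x : {classic S}) l) l.
have chu : rev_chain u by apply: rev_chain_drop.
have uE : u = x :: behead u.
  have : index (x : {classic S}) l < size l by rewrite index_mem.
  by rewrite /u => lt; rewrite (drop_nth (x : {classic S})) //= nth_index.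
have u_gt0 : 0 < size u by rewrite uE.
have leu : size u <= size l by rewrite size_drop leq_subr.
clearbody u.
(* [c 1] is the last entry of [u] and [c (size u)] its head [x]; the default is not reached for
   [1 <= i <= size u]. *)
pose c i : S := nth (x : {classic S}) u (size u - i).
have step i : 1 <= i <= size u -> exists y z,
    [/\ (c @` [set j | 1 <= j < i] `|` BB) y,
        (c @` [set j | 1 <= j < i] `|` BB) z
      & mop [set y] [set z] (c i)].
  move=> /andP[i1 iu].
  have ltu : size u - i < size u by rewrite ltn_subrL i1 u_gt0.
  have := rev_chain_drop (size u - i) chu.
  rewrite (drop_nth (x : {classic S})) //= => -[[y [z [ay az yz]]] _].
  suff av w : available (drop (size u - i).+1 u) w ->
      (c @` [set j | 1 <= j < i] `|` BB) w.
    by exists y, z; split; [apply: av|apply: av|].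
  case=> [wu|]; last by right.
  left; move: (wu); rewrite -index_mem size_drop => ltw.
  set m := index _ _ in ltw.
  have ltw' : m < i.-1.
    by move: ltw iu i1; move: (size u) (m) => N k; clear; lia.
  (* Position [m] after the entry of [c i] is position [size u - i + 1 + m] in [u], that is,
     [size u - (i - 1 - m)]. *)
  exists (i.-1 - m); last first.
    rewrite /c -[RHS](nth_index (x : {classic S}) wu) nth_drop -/m.
    by congr nth; move: ltw'; move: (size u) (m) iu i1 {ltw ltu} => N k; lia.
  by rewrite /=; lia.
exists (size u), c; split=> //; split=> //.
- by rewrite /c subnn uE.
(* Nothing precedes the first object, so both of its operands are blocks. *)
- have /step[y [z [hy hz yz]]] : 1 <= 1 <= size u by rewrite u_gt0.
  have earlier_block w : (c @` [set j | 1 <= j < 1] `|` BB) w -> BB w.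
    by case=> // -[j /=]; lia.
  by exists y, z; split; [apply: earlier_block|apply: earlier_block|].
- by move=> i /andP[i2 iu]; apply: step; rewrite iu ltnW.
Qed.

(** Once some chain exists, a shortest one does, so [xget] returns a true minimum and not its
    default. *)
Lemma assembly_index_le O r c : AAC BB O r c -> assembly_index BB O <= r.
Proof.
move=> chc; rewrite /assembly_index; case: asboolP => // _.
set A := [set _ | _]; suff /xgetPex : exists k, A k.
  by case/(_ 0) => _; apply; exact: chc.
have ex : exists k, `[< exists c, AAC BB O k c >].
  by exists r; apply/asboolP; exists c.
case: (ex_minnP ex) => k /asboolP exk mink; exists k; split=> // r' c' chc'.
by apply: mink; apply/asboolP; exists c'.
Qed.

(** * Sizes of products and the case of equality *)

Lemma asize_block x : BB x -> asize BB x = 1.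
Proof. by rewrite /asize; case: asboolP. Qed.

Lemma asize_gt0 x : assembly_multi_magma BB -> 0 < asize BB x.
Proof.
move=> hM; rewrite /asize; case: asboolP => // nBx.
set A := [set _ | _]; suff /xgetPex : exists k, A k.
  by case/(_ 0) => r [B [c [_ ->]]].
by have [r [B [c [chc _]]]] := hM x nBx; exists r.+1, r, B, c.
Qed.

Definition blocks_upto (m : nat) (B : nat -> S) :=
  forall j, 1 <= j <= 2 ^ m -> BB (B j).

Lemma blocks_upto_half (m : nat) (B : nat -> S) : blocks_upto m.+1 B ->
  blocks_upto m B /\ blocks_upto m (fun j => B (2 ^ m + j)).
Proof.
move=> hB; split=> j /andP[j1 jm]; apply: hB; rewrite expnS mul2n -addnn.
  by rewrite j1 (leq_trans jm) ?leq_addr.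
by rewrite leq_add2l jm andbT (leq_trans j1) ?leq_addl.
Qed.

Hypothesis hS : assembly_space BB.

(** Additivity is assumed only for products outside [BB]. A product that is a block has size 1, and
    the bound survives because sizes are positive. *)
Lemma asize_mop_le x y z :
  mop [set x] [set y] z -> asize BB z <= asize BB x + asize BB y.
Proof.
move=> xyz; have [Bz|nBz] := pselect (BB z); last by rewrite (hS.2 _ _ _ nBz xyz).
by rewrite (asize_block Bz) (leq_trans (asize_gt0 x hS.1)) ?leq_addr.
Qed.

Lemma asize_mop_saturated x y z (a b : nat) : mop [set x] [set y] z ->
  asize BB x <= a -> asize BB y <= b -> asize BB z = a + b ->
  asize BB x = a /\ asize BB y = b.
Proof. by move=> /asize_mop_le; lia. Qed.

Lemma asize_balanced (m : nat) (B : nat -> S) x :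
  blocks_upto m B -> balanced m B x -> asize BB x <= 2 ^ m.
Proof.
elim: m B x => [|m IHm] B x hB /=.
  by move=> ->; rewrite asize_block //; apply: hB.
have [hB1 hB2] := blocks_upto_half hB.
move=> /mopP[y [z [/(IHm _ _ hB1) hy /(IHm _ _ hB2) hz /asize_mop_le xyz]]].
by rewrite expnS mul2n -addnn (leq_trans xyz) ?leq_add.
Qed.

(** * Level lists of balanced products *)

(* [F i] lists the objects of size [2 ^ i] of a doubling assembly. *)
Definition doubling (F : nat -> seq {classic S}) :=
  [/\ forall x, x \in F 0 -> BB x,
      forall i x, x \in F i -> asize BB x = 2 ^ i
    & forall i x, x \in F i.+1 ->
        exists y z, [/\ y \in F i, z \in F i & mop [set y] [set z] x]].

Lemma doubling_cat (F G : nat -> seq {classic S}) :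
  doubling F -> doubling G -> doubling (fun i => F i ++ G i).
Proof.
move=> [F0 Fs Fm] [G0 Gs Gm]; split.
- by move=> x; rewrite mem_cat => /orP[/F0|/G0].
- by move=> i x; rewrite mem_cat => /orP[/Fs|/Gs].
- move=> i x; rewrite mem_cat => /orP[/Fm|/Gm] [y [z [hy hz xyz]]];
  by exists y, z; rewrite !mem_cat hy hz ?orbT.
Qed.

(** Maximal size at the root forces maximal size of both halves. Their level lists are merged and
    [x] is put on top; [2 ^ m %/ 2 ^ i] counts the nodes at height [i] of the product tree. *)
Lemma balanced_doubling (m : nat) (B : nat -> S) x :
  blocks_upto m B -> balanced m B x -> asize BB x = 2 ^ m ->
  exists F, [/\ doubling F, (x : {classic S}) \in F m
              & forall i, size (F i) <= 2 ^ m %/ 2 ^ i].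
Proof.
elim: m B x => [|m IHm] B x hB /=.
  move=> -> _; exists (fun i => if i is 0 then [:: B 1] else [::]).
  have B1 : BB (B 1) by apply: hB.
  split; rewrite ?inE //; last by case.
  split=> // [y|[|i] y //]; rewrite inE => /eqP-> //.
  exact: asize_block.
have [hB1 hB2] := blocks_upto_half hB.
move=> /mopP[y [z [hy hz xyz]]] sx.
have [sy sz] : asize BB y = 2 ^ m /\ asize BB z = 2 ^ m.
  apply: asize_mop_saturated xyz _ _ _.
  - exact: asize_balanced hB1 hy.
  - exact: asize_balanced hB2 hz.
  - by rewrite sx expnS mul2n -addnn.
have [F [hF yF sF]] := IHm _ _ hB1 hy sy.
have [G [hG zG sG]] := IHm _ _ hB2 hz sz.
(* Both halves are empty above level [m]. Hence putting [x] at level [m.+1] overwrites nothing, and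
   no object at level [m.+2] needs factors from the altered level. *)
have big_level i : m < i -> F i ++ G i = [::].
  move=> ltmi; have z0 : 2 ^ m %/ 2 ^ i = 0 by rewrite divn_small // ltn_exp2l.
  by move: (sF i) (sG i); rewrite z0 !leqn0 => /nilP-> /nilP->.
exists (fun i => if i == m.+1 then [:: x] else F i ++ G i).
have [FG0 FGs FGm] := doubling_cat hF hG.
split; first split=> //=.
- move=> i w; case: eqP => [-> | _]; last exact: FGs.
  by rewrite inE => /eqP->.
- move=> i w; rewrite eqSS; case: eqP => [-> | neim].
    rewrite inE => /eqP->; rewrite ltn_eqF //.
    by exists y, z; rewrite !mem_cat yF zG orbT.
  case: eqP => [-> | _]; last exact: FGm.
  by rewrite big_level.
- by rewrite eqxx inE.
move=> i; case: eqP => [->|_]; first by rewrite divnn expn_gt0.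
have [/big_level-> //|leim] := ltnP m i.
(* For [i <= m] the division is exact, so the bounds for the two halves add up. *)
rewrite size_cat expnS mul2n -addnn divnDl ?dvdn_exp2l //.
exact: leq_add.
Qed.

Lemma doubling_bigcat (H : nat) (n : nat -> nat) (P : nat -> S) :
  (forall j, 1 <= j <= H -> exists F,
     [/\ doubling F, (P j : {classic S}) \in F (n j)
       & forall i, size (F i) <= 2 ^ n j %/ 2 ^ i]) ->
  exists F, [/\ doubling F,
    forall j, 1 <= j <= H -> (P j : {classic S}) \in F (n j)
    & forall i, size (F i) <= \sum_(1 <= j < H.+1) 2 ^ n j %/ 2 ^ i].
Proof.
elim: H => [|H IHH] hP.
  by exists (fun=> [::]); split=> // j; case: j.
have [j /andP[j1 jH]|F [hF PF sF]] := IHH.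
  by apply: hP; rewrite j1 ltnW.
have [|G [hG PG sG]] := hP H.+1; first by rewrite leqnn.
exists (fun i => F i ++ G i); split.
- exact: doubling_cat.
- move=> j /andP[j1]; rewrite mem_cat leq_eqVlt => /predU1P[->|jH].
    by rewrite PG orbT.
  by rewrite PF // j1.
- by move=> i; rewrite size_cat big_nat_recr //= leq_add.
Qed.

(** * From level lists to a single chain *)

(** Level 0 consists of blocks and costs nothing; each later level uses only factors from the level
    just below, which are already available. *)
Lemma doubling_rev_chain (F : nat -> seq {classic S}) (k : nat -> nat) (N : nat) :
  doubling F -> (forall i, size (F i) <= k i) ->
  exists l, [/\ rev_chain l,
    forall i x, i <= N -> x \in F i -> available l x
    & size l <= \sum_(1 <= i < N.+1) min_card (k i) (size_class BB (2 ^ i))].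
Proof.
move=> [F0 Fs Fm] sF; elim: N => [|N [l [chl avl sl]]].
  exists [::]; split=> // i x; rewrite leqn0 => /eqP-> /F0.
  by right.
(* Removing repetitions brings in the cardinality: distinct objects of size [2 ^ N.+1] number at
   most the cardinality of their size class. *)
exists (undup (F N.+1) ++ l); split.
- apply: rev_chain_cat => // x; rewrite mem_undup => /Fm[y [z [hy hz xyz]]].
  by exists y, z; split=> //; apply: avl (leqnn N) _.
- move=> i x; rewrite leq_eqVlt => /predU1P[->|leiN] xF.
    by left; rewrite mem_cat mem_undup xF.
  apply: available_sub (avl _ _ leiN xF) => y yl.
  by rewrite mem_cat yl orbT.
- rewrite size_cat big_nat_recr //= addnC leq_add //.
  apply: min_card_uniq; first exact: undup_uniq.
    by move=> x; rewrite mem_undup => /Fs.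
  exact: leq_trans (size_undup _) (sF _).
Qed.

(** Each of the [h] outer products adds one object to the chain. *)
Lemma nested_rev_chain (P : nat -> S) (h : nat) O l :
  rev_chain l -> (forall j, 1 <= j <= h.+1 -> available l (P j)) ->
  nested P h O ->
  exists l', [/\ rev_chain l', {subset l <= l'}, available l' O
               & size l' <= size l + h].
Proof.
move=> chl; elim: h O => [|h IHh] O avP /=.
  by move=> ->; exists l; split; rewrite ?addn0 //; apply: avP.
move=> /mopP[_ [Q [-> hQ PQO]]].
have [j /andP[j1 jh]||l' [chl' sub avQ sl']] := IHh Q; first 2 last.
- exists ((O : {classic S}) :: l'); split; last by rewrite addnS.
  + split=> //; exists (P h.+2), Q; split=> //.
    by apply: available_sub sub (avP _ _); rewrite leqnn.
  + by move=> x /sub; rewrite inE orbC => ->.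
  + by left; rewrite inE eqxx.
- by apply: avP; rewrite j1 ltnW.
- by [].
Qed.

Lemma asize_nested_le (n : nat -> nat) (P : nat -> S) (h : nat) O :
  (forall j, 1 <= j <= h.+1 -> asize BB (P j) <= 2 ^ n j) ->
  nested P h O -> asize BB O <= \sum_(1 <= j < h.+2) 2 ^ n j.
Proof.
elim: h O => [|h IHh] O sP /=.
  by move=> ->; rewrite big_nat1; apply: sP.
move=> /mopP[_ [Q [-> hQ PQO]]]; rewrite big_nat_recr //= addnC.
apply: leq_trans (asize_mop_le PQO) (leq_add (sP _ _) (IHh _ _ hQ)).
  by rewrite leqnn.
by move=> j /andP[j1 jh]; apply: sP; rewrite j1 ltnW.
Qed.

(** Peel off the outermost factor: a maximal sum forces both summands to be maximal, and the inner
    product is handled by induction. *)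
Lemma asize_nested_saturated (n : nat -> nat) (P : nat -> S) (h : nat) O :
  (forall j, 1 <= j <= h.+1 -> asize BB (P j) <= 2 ^ n j) ->
  nested P h O -> asize BB O = \sum_(1 <= j < h.+2) 2 ^ n j ->
  forall j, 1 <= j <= h.+1 -> asize BB (P j) = 2 ^ n j.
Proof.
elim: h O => [|h IHh] O sP /=.
  move=> ->; rewrite big_nat1 => sO j.
  by rewrite -eqn_leq => /eqP <-.
move=> /mopP[_ [Q [-> hQ PQO]]]; rewrite big_nat_recr //= addnC => sO.
have sP' j : 1 <= j <= h.+1 -> asize BB (P j) <= 2 ^ n j.
  by move=> /andP[j1 jh]; apply: sP; rewrite j1 ltnW.
have [|sPh sQ] := asize_mop_saturated PQO _ (asize_nested_le sP' hQ) sO.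
  by apply: sP; rewrite leqnn.
move=> j /andP[j1]; rewrite leq_eqVlt => /predU1P[->//|jh].
by apply: (IHh Q) => //; rewrite j1.
Qed.

End Assembly.

Theorem theorem2 (S : multiMagma) (BB : set S) (hS : assembly_space BB)
    (O : S) (hO : binary_decomposable BB O) (H : nat) (n : nat -> nat)
    (hH : H = hamming_weight (asize BB O))
    (hn : binary_expansion (asize BB O) H n) :
  assembly_index BB O <=
    (H - 1) + \sum_(1 <= i < (n 1).+1)
      min_card (\sum_(1 <= j < H.+1) 2 ^ n j %/ 2 ^ i) (size_class BB (2 ^ i)).
Proof.
have [BO|nBO] := pselect (BB O).
  by rewrite /assembly_index; case: asboolP.
case: hO => H' [n' [hn' [B [P [hB hP nestO]]]]].
have [eqH eqn] := binary_expansion_inj hn hn'.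
rewrite -{}eqH in hn' hB hP nestO.
have {hn' hB} hB j : 1 <= j <= H -> blocks_upto BB (n j) (B j).
  by move=> jH k; rewrite eqn // => kn; apply: hB.
have {hP eqn n'} hP j : 1 <= j <= H -> balanced (n j) (B j) (P j).
  by move=> jH; rewrite eqn //; apply: hP.
(* An empty expansion would give [O] size 0, but sizes are positive. *)
case: H hH hn hB hP nestO => [_ [_ sO]|h _ [decr sO] hB hP nestO].
  by have := asize_gt0 O hS.1; rewrite sO big_geq.
have sPle j : 1 <= j <= h.+1 -> asize BB (P j) <= 2 ^ n j.
  by move=> jh; apply: (asize_balanced hS) (hP j jh); apply: hB.
(* The size of [O] attains the upper bound, so each [P j] has the exact size required to build its
   level lists. *)
have sP := asize_nested_saturated hS sPle nestO sO.
have [j jh|F [hF PF sF]] :=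
    doubling_bigcat (BB := BB) (H := h.+1) (n := n) (P := P).
  by apply: (balanced_doubling hS) (hP j jh) (sP j jh); apply: hB.
(* Levels up to [n 1], the largest exponent, already contain every [P j]. *)
have [l [chl avl sl]] := doubling_rev_chain (n 1) hF sF.
have n_max j : 1 <= j <= h.+1 -> n j <= n 1.
  by case: j => [|[|j]] // jh; apply/ltnW/decr.
have avP j : 1 <= j <= h.+1 -> available BB l (P j).
  by move=> jh; apply: (avl (n j)); [apply: n_max|apply: PF].
(* [available] also admits blocks; as [O] is not one, it must occur in the list. *)
have [l' [chl' _ [Ol'|//] sl']] := nested_rev_chain chl avP nestO.
have [r [c [chc rl']]] := rev_chain_AAC chl' Ol'.
rewrite subn1 addnC (leq_trans (assembly_index_le chc)) // (leq_trans rl') //.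
by rewrite (leq_trans sl') // leq_add2r.
Qed.
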